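(* Let $\ell\ge 2$ be an integer, let $p_1,\dots,p_\ell>0$ with $\sum_{i=1}^\ell p_i=1$, let $q>1$ be real, let $m_1,\dots,m_\ell\in\mathbb{Z}$, put $a_i:=q^{m_i}$, and let $b_1,\dots,b_\ell\in\mathbb{R}$. Assume that $(a_i,b_i)\neq(1,0)$ for all $i=1,\dots,\ell$ and that the $a_i$ are not all equal to $1$. If $\sum_{i=1}^\ell p_i m_i=0$, then any bounded continuous function $y:\mathbb{R}\to\mathbb{R}$ satisfying $$y(x)=\sum_{i=1}^\ell p_i\, y(a_i(x-b_i))\qquad\text{for all }x\in\mathbb{R}$$ is constant.
   Context: All notions used are standard. *)

(* Defs.v *)
From HB Require Import structures.
From mathcomp Require Export all_boot all_order all_algebra.
From mathcomp Require Export all_classical all_reals all_analysis.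
Export Order.TTheory GRing.Theory Num.Theory.
Export numFieldNormedType.Exports.

(* Main.v *)
(* Write f_i(x) = a_i (x - b_i); a word w in the indices acts on R with slope
   q^(drift w), drift w being the sum of its m_i.  The drift performs a centred
   random walk on Z, for which bounded subharmonic functions attain their
   maximum at every reachable point; this replaces stopping times at the
   recurrence of the walk.
   If drift u = 0, then u acts as a translation by some s, and y is
   s-periodic: phi(k) = sup_x (y(x + q^k s) - y(x)) is bounded and subharmonic,
   hence maximal at k = 0; near a maximiser x all the increments
   y(x + (j+1)s) - y(x + js), j < N, are close to phi(0), and their sum is
   bounded, so phi(0) <= 0 (and likewise for -y).
   If some such s is nonzero, conjugation by words yields periods q^k s with k
   arbitrarily negative, and a continuous y is constant.  Otherwise words act
   according to their drift only, so the f_i commute and have a common fixed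
   point c; then k |-> y(c + q^k h) is bounded and harmonic, hence constant on
   reachable k, and continuity at c gives y(c + h) = y(c). *)
From mathcomp Require Import ring lra zify.
Require Import Defs.
Set Implicit Arguments.
Unset Strict Implicit.
Unset Printing Implicit Defensive.
Local Open Scope classical_set_scope.
Local Open Scope ring_scope.

(** Induction on the range. Leftmost maximisers are singled out because a maximum that spreads to
    the left then gives a contradiction. *)
Lemma exists_first_max (R : realDomainType) (P : nat -> Prop) (f : nat -> R) (n K : nat) :
  P n -> (n <= K)%N ->
  exists k, [/\ (k <= K)%N, P k,
    forall j, (j <= K)%N -> P j -> f j <= f k &
    forall j, (j < k)%N -> P j -> f j < f k].
Proof.
move=> Pn nK.
suff H : forall L, (forall j, (j <= L)%N -> ~ P j) \/
  exists k, [/\ (k <= L)%N, P k,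
    forall j, (j <= L)%N -> P j -> f j <= f k &
    forall j, (j < k)%N -> P j -> f j < f k].
  by have [/(_ _ nK)//|//] := H K.
elim=> [|L [IH|[k [kL Pk maxk firstk]]]].
- have [P0|nP0] := pselect (P 0%N); last first.
    by left=> j; rewrite leqn0 => /eqP ->.
  by right; exists 0%N; split=> // j; rewrite leqn0 => /eqP ->.
- have [PL|nPL] := pselect (P L.+1); last first.
    by left=> j; rewrite leq_eqVlt => /predU1P[->//|]; exact: IH.
  right; exists L.+1; split=> // j; last by move=> /IH.
  by rewrite leq_eqVlt => /predU1P[->//|/IH].
- right; have [PL|nPL] := pselect (P L.+1); last first.
    exists k; split=> //; first exact: leqW.
    by move=> j; rewrite leq_eqVlt => /predU1P[->//|]; exact: maxk.
  have [fL|fL] := lerP (f L.+1) (f k).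
    exists k; split=> //; first exact: leqW.
    by move=> j; rewrite leq_eqVlt => /predU1P[->//|]; exact: maxk.
  exists L.+1; split=> // j.
    rewrite leq_eqVlt => /predU1P[->//|jL Pj].
    exact: le_trans (maxk _ jL Pj) (ltW fL).
  by move=> jL Pj; exact: le_lt_trans (maxk _ jL Pj) fL.
Qed.

(** * Maximum principle for centred walks on the integers *)

Section SubharmonicOnZ.
Context (R : realType) (l : nat) (p : 'I_l -> R).
Hypothesis p_gt0 : forall i, 0 < p i.
Hypothesis sum_p : \sum_(i < l) p i = 1.

(** The terms [p i * (c - f i)] are nonnegative and their sum is at most 0, so each vanishes. *)
Lemma mean_max_eq (c : R) (f : 'I_l -> R) :
  (forall i, f i <= c) -> c <= \sum_(i < l) p i * f i -> forall i, f i = c.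
Proof.
move=> fc cf i; apply/eqP; rewrite eq_sym -subr_eq0.
suff /eqP : p i * (c - f i) = 0 by rewrite mulf_eq0 gt_eqF ?p_gt0.
have ge0 j : true -> 0 <= p j * (c - f j).
  by move=> _; rewrite mulr_ge0 ?subr_ge0// ltW.
apply: (@psumr_eq0P _ _ xpredT (fun j => p j * (c - f j)) ge0 _ i isT).
apply/eqP; rewrite eq_le sumr_ge0// andbT.
under eq_bigr do rewrite mulrBr.
by rewrite big_split/= sumrN -mulr_suml sum_p mul1r subr_le0.
Qed.

Lemma exists_opposite_drift (m : 'I_l -> int) (i : 'I_l) :
  \sum_(i < l) p i * (m i)%:~R = 0 -> 0 < m i -> exists j, m j < 0.
Proof.
move=> pm mi; apply: contrapT => /forallNP H.
have ge0 j : true -> 0 <= p j * (m j)%:~R.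
  move=> _; rewrite mulr_ge0 ?(ltW (p_gt0 _))// ler0z.
  by rewrite leNgt; apply/negP/H.
have /eqP := @psumr_eq0P _ _ xpredT (fun j => p j * (m j)%:~R) ge0 pm i isT.
rewrite mulf_eq0 gt_eqF//= intr_eq0; lia.
Qed.

(* The barrier [eps * k] is harmonic since the walk is centred, and it forces
   [phi k - eps * k] to have a maximum on the half-line. *)
Lemma subharmonic_half_line (m : 'I_l -> int) (S : int -> Prop) (phi : int -> R)
    (B mu : R) (M : int) (i0 : 'I_l) :
  \sum_(i < l) p i * (m i)%:~R = 0 -> m i0 < 0 ->
  (forall i, - M <= m i) ->
  (forall k i, S k -> S (k + m i)) ->
  (forall k, S k -> phi k <= B) ->
  (forall k, S k -> phi k <= \sum_(i < l) p i * phi (k + m i)) ->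
  (forall k, S k -> 0 <= k <= M -> phi k <= mu) ->
  forall k, S k -> 0 <= k -> phi k <= mu.
Proof.
move=> pm mi0 leM Sm phiB phiE phiM k Sk k0; rewrite leNgt; apply/negP => muk.
(* The slope [e] is small enough that [e * k] stays below the gap [phi k - mu]. *)
have [e e0 ek] : exists2 e : R, 0 < e & mu < phi k - e * k%:~R.
  exists ((phi k - mu) / (2 * (k%:~R + 1))).
    by rewrite divr_gt0 ?subr_gt0// mulr_gt0// ltr_wpDl// ler0z.
  have k1 : 0 < k%:~R + 1 :> R by rewrite ltr_wpDl// ler0z.
  rewrite ltrBrDr -ltrBrDl invfM mulrA mulrAC ltr_pdivrMr//.
  have : 0 < phi k - mu by rewrite subr_gt0.
  have : 0 <= k%:~R :> R by rewrite ler0z.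
  nra.
pose psi (k : int) := phi k - e * k%:~R.
have psiE j : S j -> psi j <= \sum_(i < l) p i * psi (j + m i).
  move=> Sj; rewrite /psi.
  under eq_bigr do rewrite mulrBr.
  rewrite big_split/= sumrN.
  have -> : \sum_(i < l) p i * (e * (j + m i)%:~R) = e * j%:~R.
    transitivity (\sum_(i < l) (p i * (e * j%:~R) + e * (p i * (m i)%:~R))).
      by apply: eq_bigr => i _; rewrite intrD; ring.
    by rewrite big_split/= -mulr_suml -mulr_sumr sum_p pm; ring.
  by rewrite lerD2r phiE.
(* Beyond [K] the barrier pushes [psi] below [mu], so only a finite segment has to be searched. *)
have [K kK BK] : exists2 K : nat, k <= K%:Z & B - e * K%:R <= mu.
  have := Num.Theory.archi_boundP (normr_ge0 ((B - mu) / e)).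
  set N := Num.bound _ => HN.
  exists (maxn N `|k|%N); first by lia.
  rewrite lerBlDr -lerBlDl mulrC -ler_pdivrMr//.
  apply: le_trans (ler_norm _) (le_trans (ltW HN) _).
  by rewrite ler_nat leq_maxl.
have Pk : S (`|k|%N)%:Z by rewrite gez0_abs.
have kK' : (`|k| <= K)%N by lia.
have [n [nK Sn maxn firstn]] :=
  @exists_first_max R (fun n => S n%:Z) (fun n => psi n%:Z) _ _ Pk kK'.
have mun : mu < psi n%:Z.
  by apply: lt_le_trans (maxn _ kK' Pk); rewrite gez0_abs.
(* [psi n] exceeds [mu], so [n] lies outside the window, and no single step from [n] leaves the
   half-line. *)
have Mn : M < n%:Z.
  rewrite ltNge; apply/negP => nM.
  have := phiM _ Sn; rewrite nM andbT => /(_ isT); rewrite leNgt => /negP; apply.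
  apply: lt_le_trans mun _; rewrite /psi lerBlDr lerDl mulr_ge0 ?ler0z//.
  exact: ltW.
have all_max i : psi (n%:Z + m i) = psi n%:Z.
  move: i; apply: mean_max_eq; last exact: psiE.
  move=> i; have ni0 : 0 <= n%:Z + m i by have := leM i; lia.
  have [niK|Kni] := leP (n%:Z + m i) K%:Z.
    have := maxn `|(n%:Z + m i)%R|%N; rewrite gez0_abs//.
    by apply; [lia|exact: Sm].
  apply: ltW; apply: le_lt_trans mun; apply: le_trans BK; rewrite /psi.
  apply: lerB; first exact/phiB/Sm.
  by rewrite ler_pM2l// -[K%:R]/(K%:Z%:~R) ler_int ltW.
(* The step [i0] leads left to another maximiser, contradicting the choice of [n]. *)
have := firstn `|(n%:Z + m i0)%R|%N.
rewrite gez0_abs; last by have := leM i0; lia.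
rewrite all_max ltxx => H; suff : false by [].
by apply: H; [have := leM i0; lia|exact: Sm].
Qed.

Definition drift (m : 'I_l -> int) (w : seq 'I_l) : int := \sum_(i <- w) m i.

Lemma drift_nil (m : 'I_l -> int) : drift m [::] = 0.
Proof. exact: big_nil. Qed.

Lemma drift_cons (m : 'I_l -> int) i w : drift m (i :: w) = m i + drift m w.
Proof. exact: big_cons. Qed.

Lemma drift_nseq (m : 'I_l -> int) n i : drift m (nseq n i) = n%:Z * m i.
Proof.
elim: n => [|n IH]; first by rewrite drift_nil mul0r.
by rewrite /= drift_cons IH; lia.
Qed.

Lemma drift_cat (m : 'I_l -> int) v w : drift m (v ++ w) = drift m v + drift m w.
Proof. by rewrite /drift big_cat. Qed.

(** A centred walk with a nonzero step has steps of both signs. If [m i] and [m j] have opposite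
    signs, [|m j| - 1] letters [i] and [|m i|] letters [j] add up to [- m i]. *)
Lemma drift_return (m : 'I_l -> int) w :
  \sum_(i < l) p i * (m i)%:~R = 0 -> exists v, drift m v = - drift m w.
Proof.
move=> pm; elim: w => [|i w [v vE]].
  by exists [::]; rewrite drift_nil oppr0.
suff [u uE] : exists u, drift m u = - m i.
  by exists (u ++ v); rewrite drift_cat uE vE drift_cons opprD.
have [mi|mi|mi] := ltgtP (m i) 0; last by exists [::]; rewrite drift_nil mi.
- have pmN : \sum_(j < l) p j * (- m j)%:~R = 0.
    under eq_bigr do rewrite mulrNz mulrN.
    by rewrite sumrN pm oppr0.
  have [|j mj] := @exists_opposite_drift (fun j => - m j) i pmN; first by lia.
  exists (nseq `|m j|.-1 i ++ nseq `|m i| j).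
  rewrite drift_cat !drift_nseq; nia.
- have [j mj] := exists_opposite_drift pm mi.
  exists (nseq `|m j|.-1 i ++ nseq `|m i| j).
  rewrite drift_cat !drift_nseq; nia.
Qed.

(** The half-line bound, used on both sides, makes the maximum over a window wider than any step
    global. Equality in the mean then carries it along a word back to 0. *)
Lemma subharmonic_le_at0 (m : 'I_l -> int) (phi : int -> R) (B : R) :
  \sum_(i < l) p i * (m i)%:~R = 0 ->
  (forall w, phi (drift m w) <= B) ->
  (forall w, phi (drift m w) <= \sum_(i < l) p i * phi (drift m w + m i)) ->
  forall w, phi (drift m w) <= phi 0.
Proof.
move=> pm phiB phiE.
pose S k := exists w, k = drift m w.
have S0 : S 0 by exists [::]; rewrite drift_nil.
have Sm k i : S k -> S (k + m i).
  by case=> w ->; exists (w ++ [:: i]); rewrite drift_cat drift_cons drift_nil addr0.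
have phiBS k : S k -> phi k <= B by case=> w ->.
have phiES k : S k -> phi k <= \sum_(i < l) p i * phi (k + m i) by case=> w ->.
have pmN : \sum_(j < l) p j * (- m j)%:~R = 0.
  by under eq_bigr do rewrite mulrNz mulrN; rewrite sumrN pm oppr0.
have [[i mi]|m0] := pselect (exists i, m i != 0); last first.
  have {}m0 i : m i = 0 by have [//|mi] := eqVneq (m i) 0; case: m0; exists i.
  by move=> w; rewrite /drift big1.
have [ipos mipos] : exists i, 0 < m i.
  have [mi0|//|mi0] := ltgtP (m i) 0; [|by exists i|by rewrite mi0 eqxx in mi].
  have [|j mj] := @exists_opposite_drift (fun j => - m j) i pmN; first by lia.
  by exists j; lia.
have [ineg mineg] := exists_opposite_drift pm mipos.
pose M := (\sum_(i < l) `|m i|)%N.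
have mM j : (`|m j| <= M)%N by rewrite /M (bigD1 j)//= leq_addr.
(* The window from [- M] to [M] is indexed by naturals through a shift by [M]. *)
have [||n [nM [w0 w0E] maxn _]] := @exists_first_max R (fun n => S (n%:Z - M%:Z))
  (fun n => phi (n%:Z - M%:Z)) M (M + M)%N.
- by rewrite subrr.
- by rewrite leq_addr.
set k0 := n%:Z - M%:Z in w0E maxn.
have maxM k : S k -> - M%:Z <= k <= M%:Z -> phi k <= phi k0.
  move=> Sk kM; have := maxn `|(k + M%:Z)%R|%N.
  rewrite gez0_abs; last by lia.
  by rewrite addrK; apply => //; lia.
have maxk k : S k -> phi k <= phi k0.
  move=> Sk; have [k_ge0|k_lt0] := lerP 0 k.
    apply: (@subharmonic_half_line m S phi B (phi k0) M%:Z ineg) => //.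
      by move=> j; have := mM j; lia.
    by move=> j Sj jM; apply: maxM => //; lia.
  have := @subharmonic_half_line (fun j => - m j) (fun k => S (- k))
    (fun k => phi (- k)) B (phi k0) M%:Z ipos.
  move=> /(_ pmN _ _ _ _ _ _ (- k)); rewrite opprK; apply => //; [lia| | | | | |lia].
  - by move=> j; have := mM j; lia.
  - by move=> j i' Sj; rewrite opprD opprK; exact: Sm.
  - by move=> j /phiBS.
  - by move=> j /phiES; under [in X in _ -> X]eq_bigr do rewrite opprD opprK.
  - by move=> j Sj jM; apply: maxM => //; lia.
have stay w k : S k -> phi k = phi k0 -> phi (k + drift m w) = phi k0.
  elim: w k => [|j w IH] k Sk phik; first by rewrite drift_nil addr0.
  rewrite drift_cons addrA; apply: IH; first exact: Sm.
  move: j; apply: mean_max_eq; first by move=> j; exact/maxk/Sm.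
  by rewrite -phik; exact: phiES.
have [v vE] := drift_return w0 pm.
have Sk0 : S k0 by exists w0.
have := stay v k0 Sk0 erefl; rewrite vE -w0E subrr => ->.
by move=> w; apply: maxk; exists w.
Qed.

End SubharmonicOnZ.

(** * Words in the affine maps *)

Section AffineWords.
Context (R : realType) (l : nat) (p : 'I_l -> R) (q : R) (m : 'I_l -> int) (b : 'I_l -> R).
Hypothesis p_gt0 : forall i, 0 < p i.
Hypothesis sum_p : \sum_(i < l) p i = 1.
Hypothesis q_gt1 : 1 < q.
Hypothesis centred : \sum_(i < l) p i * (m i)%:~R = 0.

Definition aff (i : 'I_l) (x : R) : R := q ^ m i * (x - b i).

Definition aff_word (w : seq 'I_l) (x : R) : R := foldl (fun x i => aff i x) x w.

Definition affine_harmonic (y : R -> R) := forall x, y x = \sum_(i < l) p i * y (aff i x).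

Let q_gt0 : 0 < q. Proof. exact: lt_trans q_gt1. Qed.

Let qzD j k : q ^ (j + k) = q ^ j * q ^ k.
Proof. by rewrite expfzDr// gt_eqF. Qed.

Lemma affB i x h : aff i (x + h) = aff i x + q ^ m i * h.
Proof. rewrite /aff; ring. Qed.

Lemma aff_wordD w x h : aff_word w (x + h) = aff_word w x + q ^ drift m w * h.
Proof.
elim: w x h => [|i w IH] x h; first by rewrite drift_nil expr0z mul1r.
by rewrite /= affB IH drift_cons qzD; ring.
Qed.

Lemma aff_word_cat v w x : aff_word (v ++ w) x = aff_word w (aff_word v x).
Proof. by rewrite /aff_word foldl_cat. Qed.

Lemma loopE u x : drift m u = 0 -> aff_word u x = x + aff_word u 0.
Proof. by move=> u0; rewrite -{1}[x]add0r aff_wordD u0 expr0z mul1r addrC. Qed.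

(** * Monotonicity of bounded harmonic functions along loops *)

Section BoundedHarmonic.
Context (y : R -> R) (B : R).
Hypothesis y_bnd : forall x, `|y x| <= B.
Hypothesis y_harm : affine_harmonic y.

(* [k] records the scale: the increment of [y] over [q ^ k * s] is harmonic for
   the walk moving [x] and [k] simultaneously. *)
Lemma loop_increment_le0 u x :
  drift m u = 0 -> y (aff_word u x) <= y x.
Proof.
move=> u0; set s := aff_word u 0.
pose g x k := y (x + q ^ k * s) - y x.
pose E k := [set z | exists x, z = g x k].
have gB x' k : g x' k <= B + B.
  by rewrite /g; have := y_bnd (x' + q ^ k * s); have := y_bnd x'; rewrite !ler_norml; lra.
have ubE k : has_ubound (E k) by exists (B + B) => _ [z ->].
pose phi k := sup (E k).
have gphi x' k : g x' k <= phi k by apply: ub_le_sup => //; exists x'.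
have E0 k : E k !=set0 by exists (g 0 k), 0.
have gE x' k : g x' k = \sum_(i < l) p i * g (aff i x') (k + m i).
  rewrite /g (y_harm (x' + _)) (y_harm x') -sumrB; apply: eq_bigr => i _.
  by rewrite affB [k + _]addrC qzD mulrA; ring.
have phiE k : phi k <= \sum_(i < l) p i * phi (k + m i).
  apply: ge_sup => // _ [x' ->]; rewrite gE; apply: ler_sum => i _.
  by rewrite ler_pM2l.
have phiB k : phi k <= B + B by apply: ge_sup => // _ [x' ->].
have phi_max w : phi (drift m w) <= phi 0.
  exact: (subharmonic_le_at0 p_gt0 sum_p centred (fun w => phiB _) (fun w => phiE _)).
(* The shortfall from [phi 0] grows along [w] by a factor at most [1 / c], where [c] is the product
   of the probabilities of its letters. The word [v] keeps the scale reachable, where [phi 0] is an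
   upper bound. *)
have defect w : exists2 c, 0 < c & forall x' v,
    c * (phi 0 - g (aff_word w x') (drift m v + drift m w)) <= phi 0 - g x' (drift m v).
  elim: w => [|i w [c c0 IH]].
    by exists 1 => // x' v; rewrite mul1r drift_nil addr0.
  exists (p i * c); first by rewrite mulr_gt0.
  move=> x' v; have := IH (aff i x') (v ++ [:: i]).
  rewrite drift_cat !drift_cons drift_nil addr0 !addrA => H.
  have {}H : p i * c * (phi 0 - g (aff_word w (aff i x')) (drift m v + m i + drift m w))
      <= p i * (phi 0 - g (aff i x') (drift m v + m i)) by rewrite -mulrA ler_pM2l.
  apply: le_trans H _; rewrite (gE x').
  rewrite -[X in _ <= X - _]mul1r -sum_p mulr_suml -sumrB (bigD1 i)//= -mulrBr lerDl.
  apply: sumr_ge0 => j _; rewrite -mulrBr mulr_ge0 ?subr_ge0// ?(ltW (p_gt0 _))//.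
  apply: le_trans (gphi _ _) _.
  by have := phi_max (v ++ [:: j]); rewrite drift_cat drift_cons drift_nil addr0.
have [c c0 cE] := defect u.
have step x' : c * (phi 0 - g (x' + s) 0) <= phi 0 - g x' 0.
  have := cE x' [::]; rewrite u0 loopE// drift_nil addr0; exact.
have g0 x' : g x' 0 = y (x' + s) - y x' by rewrite /g expr0z mul1r.
rewrite loopE// -subr_le0 -g0; apply: le_trans (gphi _ _) _.
rewrite leNgt; apply/negP => phi0.
have steps n x' : c ^+ n * (phi 0 - g (x' + s *+ n) 0) <= phi 0 - g x' 0.
  elim: n x' => [|n IH] x'; first by rewrite expr0 mul1r mulr0n addr0.
  apply: le_trans (step x'); rewrite exprS -mulrA ler_pM2l//.
  by rewrite mulrS addrA.
have telescope n x' : y (x' + s *+ n) - y x' = \sum_(i < n) g (x' + s *+ i) 0.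
  elim: n => [|n IH]; first by rewrite big_ord0 mulr0n addr0 subrr.
  by rewrite big_ord_recr/= -IH g0 mulrSr addrA; ring.
have B_ge0 : 0 <= B := le_trans (normr_ge0 _) (y_bnd 0).
(* So many increments of size [phi 0 / 2] exceed [B + B], the largest possible variation of [y]. *)
pose N := Num.bound ((B + B) * 2 / phi 0).
have HN : B + B < N%:R * (phi 0 / 2).
  rewrite -ltr_pdivrMr ?divr_gt0// invf_div mulrA.
  by apply: archi_boundP; rewrite !mulr_ge0 ?invr_ge0 ?addr_ge0// ltW.
(* The minimum with 1 makes this at most [c ^+ i * (phi 0 / 2)] for every [i < N], so a start within
   [e] of the supremum keeps all [N] increments large. *)
pose e := Num.min 1 c ^+ N * (phi 0 / 2).
have m0 : 0 < Num.min 1 c by rewrite lt_min ltr01.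
have e0 : 0 < e by rewrite mulr_gt0 ?exprn_gt0 ?divr_gt0.
have [_ [x' ->] gx'] := sup_adherent e0 (conj (E0 0) (ubE 0)).
have big (i : 'I_N) : phi 0 / 2 <= g (x' + s *+ i) 0.
  have ci : Num.min 1 c ^+ N <= c ^+ i.
    apply: (@le_trans _ _ (Num.min 1 c ^+ i)).
      by apply: ler_wiXn2l; [exact: ltW|rewrite ge_min lexx|exact: ltnW].
    by rewrite lerXn2r ?nnegrE ?(ltW m0) ?(ltW c0)// ge_min lexx orbT.
  have ci0 : 0 < c ^+ i by rewrite exprn_gt0.
  have le_e : e <= c ^+ i * (phi 0 / 2) by rewrite ler_wpM2r// ltW// divr_gt0.
  have lt_e : phi 0 - g x' 0 < e by move: gx'; rewrite /phi; lra.
  have := le_lt_trans (steps i x') (lt_le_trans lt_e le_e).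
  by rewrite ltr_pM2l//; lra.
have := telescope N x'; apply/eqP; rewrite lt_eqF//.
apply: (@le_lt_trans _ _ (B + B)).
  by have := y_bnd (x' + s *+ N); have := y_bnd x'; rewrite !ler_norml; lra.
apply: (lt_le_trans HN); rewrite mulr_natl -[N in _ *+ N]card_ord -sumr_const.
exact: ler_sum.
Qed.

End BoundedHarmonic.

Lemma loop_invariant (y : R -> R) (B : R) u x :
  (forall x, `|y x| <= B) -> affine_harmonic y -> drift m u = 0 ->
  y (aff_word u x) = y x.
Proof.
move=> yB yH u0; apply/eqP; rewrite eq_le (loop_increment_le0 yB yH)//=.
have yNB z : `|- y z| <= B by rewrite normrN.
have yNH : affine_harmonic (fun z => - y z).
  by move=> z; rewrite yH -sumrN; apply: eq_bigr => i _; rewrite mulrN.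
by have := loop_increment_le0 yNB yNH x u0; rewrite lerN2.
Qed.

(** * Small scales, small periods and the common fixed point *)

Lemma drift_scale_small (e : R) : (exists i, m i != 0) -> 0 < e ->
  exists w, q ^ drift m w < e.
Proof.
move=> [i mi] e0.
have [j mj] : exists j, m j < 0.
  have [mi0|mi0|mi0] := ltgtP (m i) 0; [by exists i| |by rewrite mi0 eqxx in mi].
  exact: exists_opposite_drift mi0.
have r1 : `|q ^ m j| < 1.
  by rewrite gtr0_norm ?exprz_gt0// -(expr0z q) ltr_eXz2l.
have /cvgrPdist_lt /(_ _ e0) [n _ /(_ n (leqnn n))] := cvg_expr r1.
rewrite sub0r normrN => H; exists (nseq n j).
rewrite drift_nseq mulrC -exprz_exp; exact: le_lt_trans (ler_norm _) H.
Qed.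

Lemma small_periods_const (y : R -> R) :
  continuous y ->
  (forall e, 0 < e -> exists t, [/\ 0 < `|t|, `|t| < e & forall x, y (x + t) = y x]) ->
  forall x, y x = y 0.
Proof.
move=> yC per x; apply/eqP; rewrite -subr_eq0 -normr_le0; apply/ler_addgt0Pl => e e0.
rewrite addr0.
have /cvgrPdist_lt /(_ _ e0) [d /= d0 yd] := yC 0.
have [t [t0 td yt]] := per _ d0.
have ytn n z : y (z + t *+ n) = y z.
  by elim: n => [|n IH]; rewrite ?mulr0n ?addr0// mulrSr addrA yt.
have ytz k z : y (z + t *~ k) = y z.
  by case: k => n; [exact: ytn|rewrite NegzE mulrNz -[LHS](ytn n.+1) subrK].
(* Removing [k] periods leaves [t] times a fractional part, which is within [d] of 0. *)
pose k := Num.floor (x / t).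
have := yd (x - t *~ k).
rewrite /ball_/= sub0r normrN => H.
have -> : y x = y (x - t *~ k) by rewrite -mulrNz ytz.
rewrite distrC ltW//; apply: H.
have t_neq0 : t != 0 by rewrite -normr_gt0.
have -> : x - t *~ k = t * (x / t - k%:~R) by rewrite -mulrzr; field.
rewrite normrM; apply: le_lt_trans td.
rewrite ger_pMr//.
have /andP[k1 k2] := floor_itv (x / t); rewrite -/k intrD in k1 k2.
by rewrite ger0_norm; lra.
Qed.

(** The words [[:: i; j]] and [[:: j; i]] have equal drift, and a common return word closes both
    into trivial loops. As that word acts injectively, the maps commute, so each preserves the
    unique fixed point of a map with slope other than 1. *)
Lemma common_fixed_point :
  (exists i, m i != 0) ->
  (forall u, drift m u = 0 -> aff_word u 0 = 0) ->
  exists c, forall i, aff i c = c.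
Proof.
move=> [i mi] triv.
have comm j x : aff i (aff j x) = aff j (aff i x).
  have [v vE] := drift_return p_gt0 [:: i; j] centred.
  have loop w : drift m w = drift m [:: i; j] -> aff_word v (aff_word w x) = x.
    move=> wE; rewrite -aff_word_cat loopE ?triv ?addr0//; rewrite drift_cat vE wE; lia.
  have e1 := loop [:: i; j] erefl.
  have e2 : aff_word v (aff_word [:: j; i] x) = x.
    by apply: loop; rewrite !drift_cons; lia.
  have /eqP : aff_word v (aff_word [:: i; j] x) = aff_word v (aff_word [:: j; i] x).
    by rewrite e1 e2.
  rewrite -[aff_word [:: i; j] x in X in X == _](subrK (aff_word [:: j; i] x)) addrC.
  rewrite aff_wordD -subr_eq0 addrAC subrr add0r mulf_eq0.
  rewrite gt_eqF ?exprz_gt0//= subr_eq0 => /eqP /= H.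
  by rewrite H.
have qi : q ^ m i != 1 by rewrite pexprz_eq1 ?ltW// negb_or mi gt_eqF.
have qi1 : q ^ m i - 1 != 0 by rewrite subr_eq0.
pose c := q ^ m i * b i / (q ^ m i - 1).
have fixc x : aff i x = x -> x = c.
  rewrite /aff /c => H; apply: (mulIf qi1); rewrite divfK//; move: H; lra.
exists c => j; apply: fixc; rewrite comm.
by congr aff; rewrite /aff /c; field.
Qed.

Lemma common_fixed_point_const (y : R -> R) (B c : R) :
  (exists i, m i != 0) -> (forall x, `|y x| <= B) -> continuous y ->
  affine_harmonic y -> (forall i, aff i c = c) -> forall x, y x = y c.
Proof.
move=> m0 yB yC yH fc x.
(* Along the scales around [c], both [h] and [- h] are bounded and subharmonic, so each is largest
   at scale 0. *)
have scale w u : y (c + q ^ drift m w * u) = y (c + u).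
  pose h k := y (c + q ^ k * u).
  have hE k : h k = \sum_(i < l) p i * h (k + m i).
    rewrite /h yH; apply: eq_bigr => i _.
    by rewrite affB fc [k + _]addrC qzD mulrA.
  have hB k : h k <= B by apply: le_trans (ler_norm _) (yB _).
  have hNB k : - h k <= B by apply: le_trans (ler_norm _) _; rewrite normrN; exact: yB.
  have hle k : h k <= \sum_(i < l) p i * h (k + m i) by rewrite -hE.
  have hNle k : - h k <= \sum_(i < l) p i * - h (k + m i).
    by under eq_bigr do rewrite mulrN; rewrite sumrN -hE.
  have le1 := @subharmonic_le_at0 _ _ _ p_gt0 sum_p _ h _ centred (fun v => hB _)
    (fun v => hle _) w.
  have le2 := @subharmonic_le_at0 _ _ _ p_gt0 sum_p _ (fun k => - h k) _ centred (fun v => hNB _)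
    (fun v => hNle _) w.
  have -> : y (c + u) = h 0 by rewrite /h expr0z mul1r.
  by apply/eqP; rewrite eq_le -/(h _) le1 -lerN2 le2.
apply/eqP; rewrite -subr_eq0 -normr_le0; apply/ler_addgt0Pl => e e0.
rewrite addr0.
have /cvgrPdist_lt /(_ _ e0) [d /= d0 yd] := yC c.
have x1 : 0 < `|x - c| + 1 by rewrite ltr_wpDl.
have [w wd] := drift_scale_small m0 (divr_gt0 d0 x1).
have -> : y x = y (c + q ^ drift m w * (x - c)) by rewrite scale subrKC.
rewrite distrC ltW//; apply: yd; rewrite /ball_/= opprD addrA subrr sub0r normrN.
rewrite normrM gtr0_norm ?exprz_gt0//.
move: wd; rewrite ltr_pdivlMr//; apply: le_lt_trans.
by rewrite ler_wpM2l ?exprz_ge0 ?lerDl// ltW.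
Qed.

End AffineWords.

Theorem theorem3p9 (R : realType) (l : nat) (hl : (2 <= l)%N)
    (p : 'I_l -> R) (hp : forall i, 0 < p i) (hp1 : \sum_(i < l) p i = 1)
    (q : R) (hq : 1 < q) (m : 'I_l -> int)
    (a : 'I_l -> R) (ha : forall i, a i = q ^ m i)
    (b : 'I_l -> R)
    (hab : forall i, (a i, b i) <> (1, 0))
    (ha1 : ~ (forall i, a i = 1))
    (hpm : \sum_(i < l) p i * (m i)%:~R = 0)
    (y : R -> R) (hbd : bounded_fun y) (hcont : continuous y)
    (hy : forall x, y x = \sum_(i < l) p i * y (a i * (x - b i))) :
  exists c : R, forall x, y x = c.
Proof.
have m0 : exists i, m i != 0.
  apply: contrapT => /forallNP H; apply: ha1 => i; rewrite ha.
  by have [->|mi] := eqVneq (m i) 0; [rewrite expr0z|case: (H i)].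
have yH : affine_harmonic p q m b y.
  by move=> x; rewrite hy; apply: eq_bigr => i _; rewrite /aff ha.
have [B yB] : exists B, forall x, `|y x| <= B.
  case: hbd => M [_ HM]; exists (M + 1) => x.
  by apply: HM => //; rewrite ltrDl.
(* Either some loop is a nonzero translation, or all loops act trivially. *)
have [[u [u0 su]]|triv] :=
  pselect (exists u, drift m u = 0 /\ aff_word q m b u 0 != 0); last first.
  have {}triv u : drift m u = 0 -> aff_word q m b u 0 = 0.
    move=> u0; by have [//|su] := eqVneq (aff_word q m b u 0) 0; case: triv; exists u.
  have [c fc] := common_fixed_point hp hq hpm m0 triv.
  by exists (y c); exact: (common_fixed_point_const hp hp1 hq hpm m0 yB hcont yH fc).
exists (y 0); apply: small_periods_const => // e e0.
set s := aff_word q m b u 0 in su.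
have s0 : 0 < `|s| by rewrite normr_gt0.
have [v vE] := drift_scale_small hp hq hpm m0 (divr_gt0 e0 s0).
(* Since [w] undoes the drift of [v], both [w ++ v] and [w ++ u ++ v] are loops, and [y] agrees at
   their endpoints when they start from the same point. *)
have [w wE] := drift_return hp v hpm.
exists (q ^ drift m v * s).
have qv : 0 < q ^ drift m v by rewrite exprz_gt0// (lt_trans ltr01).
split.
- by rewrite normrM mulr_gt0// normr_gt0 gt_eqF.
- by rewrite normrM gtr0_norm// -ltr_pdivlMr.
(* Conjugating the translation by [s] with the words [w], [v] rescales it. *)
move=> x.
pose z := x - aff_word q m b (w ++ v) 0.
have wv0 : drift m (w ++ v) = 0 by rewrite drift_cat wE addNr.
have -> : x = aff_word q m b (w ++ v) z by rewrite loopE// subrK.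
have -> : aff_word q m b (w ++ v) z + q ^ drift m v * s = aff_word q m b (w ++ u ++ v) z.
  by rewrite !aff_word_cat (loopE b hq (u := u))// aff_wordD.
have wuv0 : drift m (w ++ u ++ v) = 0 by rewrite !drift_cat u0 add0r wE addNr.
by rewrite !(loop_invariant hp hp1 hq hpm _ yB yH).
Qed.
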